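(* Algorithm Online_SumFj (described in the context) is 2-competitive for the online problem $1|jrp,s=1,p_j=1,r_j|\sum F_j+c_\mathcal{Q}$; that is, on every instance the cost of the solution it produces is at most twice the optimal offline cost.
   Context: Problem $1|jrp,s=1,p_j=1,r_j|\sum F_j+c_\mathcal{Q}$: jobs with processing time $1$ and nonnegative integer release dates $r_j$ must be processed non-preemptively on a single machine (at most one job at a time). There is a single resource, required by every job; each replenishment of it costs $K:=K_0+K_1\ge0$. A solution consists of start times $S_j$ (completion times $C_j=S_j+1$) and replenishment times $t_1<\dots<t_q$; it is feasible if no two jobs overlap and for each job $j$ some replenishment time lies in $[r_j,S_j]$. Its cost is $\sum_jF_j+qK$, where $F_j=C_j-r_j$. Online setting: jobs are not known in advance (neither their number nor their data); a job becomes known at its release date. Time proceeds in integer steps; at each time $t$ the algorithm first learns the jobs released at $t$, then decides whether to replenish at $t$, then may start jobs; decisions cannot be revoked. An online algorithm is $c$-competitive if on every instance its cost is at most $c$ times the optimal offline cost. Let $G(a)=a(a+1)/2$. Algorithm Online_SumFj: start with $t:=0$. Repeat: let $B_t$ be the set of jobs released by time $t$ that are not yet scheduled; if $\sum_{j\in B_t}(t-r_j)+G(|B_t|)\ge K$, then replenish the resource at $t$, start the jobs of $B_t$ consecutively from time $t$ without idle time in increasing release date order, and set $t:=t+|B_t|$; otherwise set $t:=t+1$.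
   Formalization: The algorithm's test is applied only when B_t is nonempty; for K > 0 this changes nothing, but for K = 0 the algorithm as literally described would, with B_t empty, replenish and set t := t + 0 forever. *)

(* Defs.v *)
From HB Require Import structures.
From mathcomp Require Export all_boot all_order all_algebra.
From mathcomp Require Export classical_sets reals.

Set Implicit Arguments.
Unset Strict Implicit.
Unset Printing Implicit Defensive.

Import Order.TTheory GRing.Theory Num.Theory.
Local Open Scope ring_scope.

(* An instance is the number n of jobs with their release dates r : 'I_n -> nat.
   Offline solutions may use arbitrary real start and replenishment times. *)

Record solution (R : realType) (n : nat) := Solution {
  start : 'I_n -> R;
  replenishments : seq R
}.

Definition feasible (R : realType) (n : nat) (r : 'I_n -> nat)
    (s : solution R n) : Prop :=
  [/\ sorted <%R (replenishments s),
      forall i j : 'I_n, i != j ->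
        start s i + 1 <= start s j \/ start s j + 1 <= start s i
    & forall j : 'I_n, exists2 t : R,
        t \in replenishments s & (r j)%:R <= t <= start s j].

Definition completion (R : realType) (n : nat) (s : solution R n) (j : 'I_n) : R :=
  start s j + 1.

Definition flow_time (R : realType) (n : nat) (r : 'I_n -> nat)
    (s : solution R n) (j : 'I_n) : R :=
  completion s j - (r j)%:R.

Definition cost (R : realType) (K : R) (n : nat) (r : 'I_n -> nat)
    (s : solution R n) : R :=
  \sum_(j < n) flow_time r s j + (size (replenishments s))%:R * K.

Definition opt_cost (R : realType) (K : R) (n : nat) (r : 'I_n -> nat) : R :=
  inf [set cost K r s | s in [set s : solution R n | feasible r s]]%classic.

(* What has been decided strictly before time [clock]: the pairs (job, start
   time) and the replenishment times. *)
Record log := Log {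
  clock : nat;
  started : seq (nat * nat);
  replenished : seq nat
}.

(* Whenever the machine is free, an online algorithm is given the pairs
   (job, release date) of the jobs released by time [clock], and its log; it
   answers whether to replenish now, and which jobs (possibly none) to start
   consecutively from now on.  It is consulted again when these jobs are
   completed, or at the next integer time if it starts none. *)
Definition online_algorithm := seq (nat * nat) -> log -> bool * seq nat.

Definition released (n : nat) (r : 'I_n -> nat) (t : nat) : seq (nat * nat) :=
  [seq (val j, r j) | j <- enum 'I_n & (r j <= t)%N].

Definition advance (A : online_algorithm) (n : nat) (r : 'I_n -> nat)
    (L : log) : log :=
  let t := clock L in
  let d := A (released r t) L in
  Log (t + maxn 1 (size d.2))
      (started L ++ zip d.2 (iota t (size d.2)))
      (if d.1 then rcons (replenished L) t else replenished L).

Definition run (A : online_algorithm) (n : nat) (r : 'I_n -> nat) (k : nat) : log :=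
  iter k (advance A r) (Log 0 [::] [::]).

Definition complete (n : nat) (L : log) : Prop :=
  forall j : 'I_n, val j \in unzip1 (started L).

(* From iteration k on, nothing is started or replenished any more, so that the
   k-th log holds the whole solution. *)
Definition settled (A : online_algorithm) (n : nat) (r : 'I_n -> nat) (k : nat) : Prop :=
  forall m : nat, (k <= m)%N ->
    started (run A r m) = started (run A r k) /\
    replenished (run A r m) = replenished (run A r k).

(* Meaningful for complete logs only: a job that is not started gets 0. *)
Definition solution_of (R : realType) (n : nat) (L : log) : solution R n :=
  Solution
    (fun j : 'I_n =>
      (nth 0%N (unzip2 (started L)) (index (val j) (unzip1 (started L))))%:R)
    [seq t%:R | t <- replenished L].

Definition produces (R : realType) (A : online_algorithm) (n : nat)
    (r : 'I_n -> nat) (s : solution R n) : Prop :=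
  exists k : nat,
    [/\ settled A r k, complete n (run A r k) & s = solution_of R n (run A r k)].

Definition competitive (R : realType) (K c : R) (A : online_algorithm) : Prop :=
  forall (n : nat) (r : 'I_n -> nat),
    exists s : solution R n,
      [/\ produces A r s, feasible r s & cost K r s <= c * opt_cost K r].

Definition G (R : realType) (a : R) : R := a * (a + 1) / 2.

Definition backlog (known : seq (nat * nat)) (L : log) : seq (nat * nat) :=
  [seq j <- known | j.1 \notin unzip1 (started L)].

(* The test B != [::] only matters when K = 0: without it the empty backlog
   would satisfy the condition 0 >= K and the clock would advance by 0 forever.
   The sort is stable, so that ties are broken by job number. *)
Definition Online_SumFj (R : realType) (K : R) : online_algorithm :=
  fun known L =>
    let t := clock L in
    let B := backlog known L in
    if (B != [::]) &&
       (K <= \sum_(j <- B) (t%:R - j.2%:R) + G (size B)%:R)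
    then (true, unzip1 (sort (fun i j => (i.2 <= j.2)%N) B))
    else (false, [::]).

(* Main.v *)
(** List the start times of an offline solution in increasing order and assign
    them to the jobs in the order of release: the solution stays feasible and
    keeps its total flow time. Let the algorithm start a batch of [d] jobs at
    time [t]; let [F] be their flow time, [O] their offline flow time, and [m]
    the number of offline replenishments before [t] but not before the previous
    replenishment of the algorithm. These windows are disjoint, so it suffices
    that [F + K <= 2 * (O + m * K)] for every batch. If [m = 0], then the
    offline solution starts the batch at [t] or later, so that [K <= F <= O].
    Otherwise two facts are combined.
    - [F <= O + K + p * d - p ^ 2] for some [p] with [p ^ 2 <= K]. After
      waiting, let [p] count the jobs of the batch that the offline solution
      starts before [t]. They were released early enough for each to contribute
      at least [p] to the cost of the backlog at [t - 1], which is at most [K];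
      they are late by at most [K] in total, and the other jobs by at most [p]
      each. So the offline solution is at most [sqrt K] jobs ahead, and it
      cannot get further ahead while the machine is busy.
    - [p * d <= O + (m + 1) * p ^ 2 / 2], because the offline replenishments
      split the batch into at most [m + 1] groups, and a group of [g] jobs has
      flow time at least [G g >= p * g - p ^ 2 / 2]. *)

From mathcomp Require Import ring lra zify.
Require Import Defs.

Set Implicit Arguments.
Unset Strict Implicit.
Unset Printing Implicit Defensive.

Import Order.TTheory GRing.Theory Num.Theory.
Local Open Scope ring_scope.

Lemma antitone_cut (P : pred nat) (c e : nat) :
  (c <= e)%N -> (forall i j, (c <= i)%N -> (i <= j < e)%N -> P j -> P i) ->
  exists2 y, (c <= y <= e)%N & forall k, (c <= k < e)%N -> P k = (k < y)%N.
Proof.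
move=> ce anti; pose d := find (predC P) (iota c (e - c)).
have de : (d <= e - c)%N by rewrite -[leqRHS](size_iota c) find_size.
exists (c + d)%N => [|k /andP[ck ke]]; first lia.
have [kd|dk] := ltnP k (c + d).
  have kc : (k - c < d)%N by lia.
  have := before_find 0%N kc; rewrite nth_iota ?subnKC //; last lia.
  by move/negbFE.
have : has (predC P) (iota c (e - c)) by rewrite has_find size_iota -/d; lia.
move/(nth_find 0%N); rewrite -/d nth_iota /=; last lia.
by apply: contraNF; apply: anti; lia.
Qed.

Lemma natr_subn_split (R : pzSemiRingType) (c y e : nat) :
  (c <= y)%N -> (y <= e)%N -> (e - c)%:R = (y - c)%:R + (e - y)%:R :> R.
Proof. by move=> cy ye; rewrite -natrD; congr _%:R; lia. Qed.

(** * Jobs served in the order of release *)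

Section Flow.
Variable R : realType.
Implicit Types (rho : nat -> nat) (sigma : nat -> R).

Definition flow rho sigma (c e : nat) : R :=
  \sum_(c <= k < e) (sigma k + 1 - (rho k)%:R).

Definition batch_flow rho (t c e : nat) : R :=
  flow rho (fun k => (t + (k - c))%:R) c e.

Lemma flow_ge0 rho sigma c e :
  (forall k, (c <= k < e)%N -> (rho k)%:R <= sigma k) ->
  0 <= flow rho sigma c e.
Proof.
by move=> rho_le; rewrite /flow big_nat; apply: sumr_ge0 => k /rho_le; lra.
Qed.

Lemma flow_cat rho sigma c y e : (c <= y)%N -> (y <= e)%N ->
  flow rho sigma c e = flow rho sigma c y + flow rho sigma y e.
Proof. exact: big_cat_nat. Qed.

Lemma sum_succ_G c e :
  \sum_(c <= k < e) ((k - c)%:R + 1) = G (e - c)%:R :> R.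
Proof.
rewrite -{1}[c]add0n big_addn; under eq_bigr do rewrite addnK.
elim: (e - c)%N => [|d IH]; first by rewrite big_geq // /G !mul0r.
by rewrite big_nat_recr //= IH /G -natr1; field.
Qed.

Lemma batch_flowE rho t c e : batch_flow rho t c e =
  \sum_(c <= k < e) (t%:R - (rho k)%:R) + G (e - c)%:R.
Proof.
rewrite -sum_succ_G -big_split; apply: eq_bigr => k _.
by rewrite natrD /=; ring.
Qed.

Lemma mul_le_G (p : R) (d : nat) : p * d%:R <= p ^+ 2 / 2 + G d%:R.
Proof.
have : 0 <= (p - d%:R) ^+ 2 by exact: sqr_ge0.
by have : 0 <= d%:R :> R by []; rewrite /G sqrrB; lra.
Qed.

End Flow.

Arguments batch_flow {R} rho t c e.

Section FifoSchedule.
Variables (R : realType) (n : nat) (rho : nat -> nat).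
Implicit Types (l taus : seq R) (sigma : nat -> R).

Definition served l sigma (c e : nat) : Prop :=
  forall k, (c <= k < e)%N ->
    exists2 tau, tau \in l & (rho k)%:R <= tau <= sigma k.

Definition spaced sigma : Prop :=
  forall i j, (i <= j < n)%N -> sigma i + (j - i)%:R <= sigma j.

Lemma spaced_succ sigma :
  (forall k, (k.+1 < n)%N -> sigma k + 1 <= sigma k.+1) -> spaced sigma.
Proof.
move=> step i j /andP[/subnKC <-]; rewrite addKn.
elim: (j - i)%N => [|d IH] idn; first by rewrite addn0 addr0.
rewrite addnS in idn *; have := step _ idn; have := IH (ltnW idn).
by rewrite -natr1; lra.
Qed.

Record fifo_schedule taus sigma : Prop := FifoSchedule {
  fifo_sorted : sorted <%R taus;
  fifo_spaced : spaced sigma;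
  fifo_served : served taus sigma 0 n
}.

Definition released_before (t : nat) : nat :=
  count (fun k => (rho k < t)%N) (iota 0 n).

Lemma released_before0 : released_before 0 = 0%N.
Proof. exact: count_pred0. Qed.

Lemma released_before_le_size t : (released_before t <= n)%N.
Proof. by rewrite -[leqRHS](size_iota 0) count_size. Qed.

Lemma leq_released_before : {homo released_before : s t / (s <= t)%N}.
Proof. by move=> s t st; apply: sub_count => k /leq_trans; apply. Qed.

Hypothesis rho_nondecreasing : forall i j, (i <= j < n)%N -> (rho i <= rho j)%N.

Lemma ltn_released_before t k :
  (k < n)%N -> (rho k < t)%N = (k < released_before t)%N.
Proof.
move=> kn; have rho_sorted : sorted <=%O (mkseq rho n).
  apply/(sortedP 0%N) => i; rewrite size_mkseq => i1n.
  by rewrite !nth_mkseq //; [apply: rho_nondecreasing; lia | lia].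
have -> : released_before t = count (< t)%O (mkseq rho n) by rewrite count_map.
rewrite -(nth_mkseq 0%N rho kn); have [lt_count|ge_count] := ltnP k (count _ _).
  exact: (nth_count_lt 0%N rho_sorted lt_count).
apply/negbTE; rewrite -leqNgt; apply: (nth_count_ge 0%N rho_sorted).
by rewrite ge_count size_mkseq.
Qed.

Lemma flow_ge_G sigma c e : spaced sigma -> (e <= n)%N ->
  (forall k, (c <= k < e)%N -> (rho k)%:R <= sigma c) ->
  G (e - c)%:R <= flow rho sigma c e.
Proof.
move=> sp en rho_le; rewrite -sum_succ_G; apply: ler_sum_nat => k cke.
have /sp : (c <= k < n)%N by lia.
by have := rho_le k cke; lra.
Qed.

(* Each replenishment serves a group of [d] jobs, of flow time at least
   [G d >= p * d - p ^ 2 / 2]. *)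
Lemma served_flow_ge (p : R) l sigma c e :
  spaced sigma -> sorted <%R l -> (c <= e <= n)%N -> served l sigma c e ->
  p * (e - c)%:R <= (size l)%:R * (p ^+ 2 / 2) + flow rho sigma c e.
Proof.
move=> sp; elim: l c => [|tau l IH] c l_sorted /andP[ce en] c_served.
  have [ec|/(conj (leqnn c))/andP/c_served[]//] := leqP e c.
  by rewrite /flow big_geq // (eqP ec) mulr0 mul0r addr0.
move: l_sorted; rewrite /= lt_path_sortedE => /andP[/allP tau_lt l_sorted].
have [|y /andP[cy ye] cut] := @antitone_cut (fun k => (rho k)%:R <= tau) c e ce.
  move=> i j ci ije; apply: le_trans; rewrite ler_nat.
  by apply: rho_nondecreasing; lia.
have group : G (y - c)%:R <= flow rho sigma c y.
  apply: flow_ge_G => // [|k /andP[ck ky]]; first exact: leq_trans en.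
  have [|tau' tau'_in /andP[_ tau'_le]] := c_served c; first by lia.
  have rho_tau : (rho k)%:R <= tau by rewrite cut ?ky //; lia.
  apply: le_trans tau'_le; apply: le_trans rho_tau _.
  by move: tau'_in; rewrite in_cons => /predU1P[->//|/tau_lt/ltW].
have rest : served l sigma y e.
  move=> k /andP[yk ke]; have cke : (c <= k < e)%N by lia.
  have [tau' tau'_in /andP[rho_le le_sigma]] := c_served k cke.
  exists tau'; last by rewrite rho_le.
  move: tau'_in; rewrite in_cons => /predU1P[tau'E|//].
  by move: rho_le; rewrite tau'E cut // ltnNge yk.
have := IH y l_sorted _ rest; rewrite ye => /(_ en).
rewrite (flow_cat rho sigma cy ye) -[(size l).+1%:R]natr1.
rewrite (natr_subn_split R cy ye).
by have := mul_le_G p (y - c); rewrite mulrDr; lra.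
Qed.

Lemma batch_flow_le sigma t c e : spaced sigma -> (e <= n)%N ->
  ((c < e)%N -> t%:R <= sigma c) -> batch_flow rho t c e <= flow rho sigma c e.
Proof.
move=> sp en t_le; apply: ler_sum_nat => k cke; have /t_le : (c < e)%N by lia.
have /sp : (c <= k < n)%N by lia.
by rewrite natrD; lra.
Qed.

Lemma backlog_flow_prefix u c y : (c <= y <= released_before u.+1)%N ->
  batch_flow rho u c y <= batch_flow rho u c (released_before u.+1) :> R.
Proof.
move=> /andP[cy ya]; rewrite /batch_flow (flow_cat _ _ cy ya) lerDl.
have an := released_before_le_size u.+1.
apply: flow_ge0 => k yka; rewrite ler_nat.
by have : (rho k < u.+1)%N by [rewrite ltn_released_before; lia]; lia.
Qed.

Section OfflineSchedule.
Variables (K : R) (taus : seq R) (sigma : nat -> R).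
Hypothesis fifo : fifo_schedule taus sigma.
Let sigma_spaced : spaced sigma := fifo_spaced fifo.

Lemma fifo_release_le k : (k < n)%N -> (rho k)%:R <= sigma k.
Proof. by move/(fifo_served fifo) => [tau _ /andP[]]; exact: le_trans. Qed.

Definition lead_le_sqrt (t c : nat) : Prop :=
  forall k, (c <= k < n)%N -> (t + (k - c))%:R <= sigma k + Num.sqrt K.

Definition small_backlog (u c : nat) : Prop :=
  batch_flow rho u c (released_before u.+1) <= K.

Definition delay_bounded (t c e : nat) : Prop :=
  exists2 p : R, p ^+ 2 <= K &
    batch_flow rho t c e <= flow rho sigma c e + (K + p * (e - c)%:R - p ^+ 2).

Lemma lead_delay_bounded t c e :
  0 <= K -> lead_le_sqrt t c -> (c <= e <= n)%N -> delay_bounded t c e.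
Proof.
move=> K_ge0 lead /andP[ce en]; exists (Num.sqrt K); rewrite sqr_sqrtr //.
rewrite addrAC subrr add0r mulr_natr -sumr_const_nat -big_split.
apply: ler_sum_nat => k cke /=; have /lead : (c <= k < n)%N by lia.
lra.
Qed.

Lemma release_before_lead u i j : (i <= j < n)%N -> sigma j < u.+1%:R ->
  (rho i + (j - i) <= u)%N.
Proof.
move=> ijn sigma_j; rewrite -ltnS -(ltr_nat R) natrD.
have := sigma_spaced ijn; have /fifo_release_le : (i < n)%N by lia.
lra.
Qed.

(* The jobs [c <= k < y] are those that start before [u + 1]. *)
Lemma small_backlog_cut u c :
  (c <= released_before u.+1)%N -> small_backlog u c ->
  exists y, [/\ (c <= y <= released_before u.+1)%N, (y - c)%:R ^+ 2 <= K &
    forall k, (y <= k < n)%N -> (u.+1 + (k - y))%:R <= sigma k].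
Proof.
move=> ca backlogK; have an := released_before_le_size u.+1.
have cn := leq_trans ca an.
have [|y /andP[cy yn] cut] := @antitone_cut (fun k => sigma k < u.+1%:R) c n cn.
  move=> i j _ ijn; apply: le_lt_trans; have := sigma_spaced ijn.
  by have : 0 <= (j - i)%:R :> R by []; lra.
have released_early i j : (c <= i <= j)%N -> (j < y)%N ->
    (rho i + (j - i) <= u)%N.
  by move=> cij jy; apply: release_before_lead; [lia | rewrite cut; lia].
have ya : (y <= released_before u.+1)%N.
  rewrite leqNgt; apply/negP => ay.
  have : (rho (released_before u.+1) < u.+1)%N.
    have := released_early (released_before u.+1) _ _ ay.
    by rewrite subnn addn0; apply; rewrite ca /=.
  by rewrite ltn_released_before ?ltnn //; lia.
exists y; rewrite cy ya; split=> // [|k ykn]; last first.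
  have : u.+1%:R <= sigma y by rewrite leNgt cut ?ltnn //; lia.
  by rewrite natrD; have := sigma_spaced ykn; lra.
have cya : (c <= y <= released_before u.+1)%N by rewrite cy.
apply: le_trans (le_trans (backlog_flow_prefix cya) backlogK).
rewrite expr2 mulr_natr -sumr_const_nat; apply: ler_sum_nat => k cky.
have : (y - c + rho k <= u + (k - c) + 1)%N
  by have := released_early k y.-1; lia.
by rewrite -(ler_nat R) !natrD; lra.
Qed.

Lemma small_backlog_delay_bounded u c e :
  (c <= released_before u.+1 <= e)%N -> (e <= n)%N -> small_backlog u c ->
  delay_bounded u.+1 c e.
Proof.
move=> /andP[ca ae] en backlogK.
have [y [/andP[cy ya] yK late]] := small_backlog_cut ca backlogK.
have ye := leq_trans ya ae.
exists (y - c)%:R => //.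
rewrite [X in X <= _]/batch_flow !(flow_cat _ _ cy ye).
have early : flow rho (fun k => (u.+1 + (k - c))%:R) c y <=
    flow rho sigma c y + K.
  apply: le_trans (_ : _ <= flow rho sigma c y + batch_flow rho u c y) _.
    rewrite /batch_flow /flow -big_split; apply: ler_sum_nat => k cky.
    have /fifo_release_le : (k < n)%N by lia.
    by rewrite addSn -natr1 /=; lra.
  by rewrite lerD2l (le_trans _ backlogK) // backlog_flow_prefix ?cy.
have on_time : flow rho (fun k => (u.+1 + (k - c))%:R) y e <=
    flow rho sigma y e + (y - c)%:R * (e - y)%:R.
  rewrite mulr_natr -sumr_const_nat -big_split; apply: ler_sum_nat => k yke.
  have /late : (y <= k < n)%N by lia.
  have -> : (u.+1 + (k - c) = u.+1 + (k - y) + (y - c))%N by lia.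
  by rewrite [X in X + 1]natrD /=; lra.
by rewrite (natr_subn_split R cy ye) mulrDr expr2; lra.
Qed.

Lemma lead_le_sqrt_batch t c e :
  (c <= e)%N -> lead_le_sqrt t c -> lead_le_sqrt (t + (e - c)) e.
Proof.
move=> ce lead k ekn; have /lead : (c <= k < n)%N by lia.
by have -> : (t + (k - c) = t + (e - c) + (k - e))%N by lia.
Qed.

Lemma small_backlog_lead_le_sqrt u c e :
  (c <= released_before u.+1 <= e)%N -> small_backlog u c ->
  lead_le_sqrt (u.+1 + (e - c)) e.
Proof.
move=> /andP[ca ae] /(small_backlog_cut ca)[y [/andP[cy ya] yK late]] k ekn.
have y_le : (y - c)%:R <= Num.sqrt K.
  by rewrite -[leLHS]ger0_norm // -sqrtr_sqr ler_wsqrtr.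
have /late : (y <= k < n)%N by lia.
have -> : (u.+1 + (e - c) + (k - e) = u.+1 + (k - y) + (y - c))%N by lia.
by rewrite [in X in _ -> X]natrD; lra.
Qed.

(* A replenishment at [t] can stand in for all later ones. *)
Lemma served_window w t c e :
  (e <= n)%N -> (released_before w <= c)%N -> (e <= released_before t.+1)%N ->
  served (rcons [seq tau <- taus | w%:R <= tau < t%:R] t%:R) sigma c e.
Proof.
move=> en wc et k cke; have kn : (k < n)%N by lia.
have wk : (w <= rho k)%N by rewrite leqNgt ltn_released_before //; lia.
have kt : (rho k <= t)%N by rewrite -ltnS ltn_released_before //; lia.
have [tau tau_in /andP[rho_tau tau_sigma]] := fifo_served fifo (k := k) kn.
have [tau_lt|tau_ge] := ltP tau t%:R.
  exists tau; last by rewrite rho_tau.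
  rewrite mem_rcons inE mem_filter tau_in tau_lt !andbT.
  by rewrite (le_trans _ rho_tau) ?orbT // ler_nat.
by exists t%:R; rewrite ?mem_rcons ?mem_head // ler_nat kt (le_trans tau_ge).
Qed.

Lemma batch_cost_le w t c e :
  0 <= K -> (released_before w <= c)%N -> (c <= e <= released_before t.+1)%N ->
  K <= batch_flow rho t c e -> delay_bounded t c e ->
  batch_flow rho t c e + K <= 2 * (flow rho sigma c e
    + (count (fun tau => w%:R <= tau < t%:R) taus)%:R * K).
Proof.
move=> K_ge0 wc /andP[ce et] Kf [p pK delay].
have en : (e <= n)%N := leq_trans et (released_before_le_size _).
have := served_window en wc et; rewrite -size_filter.
set window := [seq tau <- taus | _].
have : all (< t%:R) window.
  by rewrite all_filter; apply/allP => tau _; apply/implyP => /andP[].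
have : sorted <%R window.
  by apply: sorted_filter (fifo_sorted fifo); exact: lt_trans.
case: window => [|tau l] l_sorted l_lt l_served.
  have : batch_flow rho t c e <= flow rho sigma c e.
    apply: batch_flow_le => // lt_ce; have [|tau] := l_served c; first by lia.
    by rewrite inE => /eqP -> /andP[].
  rewrite mul0r; lra.
have : sorted <%R (rcons (tau :: l) t%:R).
  rewrite /= rcons_path [path _ _ _]l_sorted.
  exact: (allP l_lt) (mem_last _ _).
have cen : (c <= e <= n)%N by rewrite ce.
move=> /(served_flow_ge p sigma_spaced)/(_ cen l_served).
rewrite size_rcons /= -[_.+2%:R]natr1 -[_.+1%:R]natr1.
have : (size l)%:R * p ^+ 2 <= (size l)%:R * K by exact: ler_wpM2l.
have : 0 <= (size l)%:R * K by exact: mulr_ge0.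
lra.
Qed.

End OfflineSchedule.

End FifoSchedule.

(** * Offline solutions *)

Section OrderBy.
Variables (n : nat) (d : Order.disp_t) (T : orderType d).
Variables (x0 : T) (f : 'I_n -> T).

Definition order_by : seq 'I_n := sort (relpre f <=%O) (enum 'I_n).

Definition nth_by (k : nat) : T := nth x0 [seq f j | j <- order_by] k.

Lemma uniq_order_by : uniq order_by.
Proof. by rewrite sort_uniq enum_uniq. Qed.

Lemma size_order_by : size order_by = n.
Proof. by rewrite size_sort size_enum_ord. Qed.

Lemma mem_order_by j : j \in order_by.
Proof. by rewrite mem_sort mem_enum. Qed.

Lemma index_order_by_lt j : (index j order_by < n)%N.
Proof. by rewrite -[ltnRHS]size_order_by index_mem mem_order_by. Qed.

Lemma nth_by_index j : nth_by (index j order_by) = f j.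
Proof. by rewrite /nth_by (nth_map j) ?nth_index ?index_mem ?mem_order_by. Qed.

Lemma nth_by_exists k : (k < n)%N -> exists j, nth_by k = f j.
Proof.
move=> kn; exists (nth (Ordinal kn) order_by k).
by rewrite /nth_by (nth_map (Ordinal kn)) ?size_order_by.
Qed.

Lemma le_nth_by i j : (i <= j < n)%N -> (nth_by i <= nth_by j)%O.
Proof.
move=> /andP[ij jn]; apply: (sorted_leq_nth le_trans lexx) => //.
- by rewrite sorted_map; apply: sort_sorted => x y; exact: le_total.
- by rewrite inE size_map size_order_by (leq_ltn_trans ij).
- by rewrite inE size_map size_order_by.
Qed.

Lemma sum_index_order_by (V : nmodType) (F : nat -> V) :
  \sum_(j < n) F (index j order_by) = \sum_(0 <= k < n) F k.
Proof.
pose rank j := Ordinal (index_order_by_lt j).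
have rank_inj : injective rank.
  by move=> i j [] /index_inj -> //; exact: mem_order_by.
by rewrite big_mkord [RHS](reindex_inj rank_inj).
Qed.

Lemma sum_nth_by (V : nmodType) (F : T -> V) :
  \sum_(j < n) F (f j) = \sum_(0 <= k < n) F (nth_by k).
Proof.
by rewrite -sum_index_order_by; apply: eq_bigr => j _; rewrite nth_by_index.
Qed.

End OrderBy.

Section Feasible.
Variables (R : realType) (n : nat) (r : 'I_n -> nat) (s : solution R n).
Local Notation release := (nth_by 0%N r).
Local Notation nth_start := (nth_by 0 (start s)).

Lemma feasible_spaced : feasible r s -> spaced n nth_start.
Proof.
move=> [_ disjoint _]; apply: spaced_succ => k k1n.
have := @le_nth_by n _ _ 0 (start s) k k.+1; rewrite leqnSn => /(_ k1n).
rewrite /nth_by !(nth_map (Ordinal k1n)) ?size_order_by // 1?ltnW //.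
set i := nth _ _ k; set j := nth _ _ k.+1.
have ij : i != j.
  by rewrite nth_uniq ?size_order_by ?uniq_order_by ?ltn_eqF // ltnW.
by have [] := disjoint _ _ ij; lra.
Qed.

(* Among the jobs with the [k + 1] earliest starts, one is not among the [k]
   first released. *)
Lemma feasible_served :
  feasible r s -> served release (replenishments s) nth_start 0 n.
Proof.
move=> [_ _ job_served] k /= kn.
have /subsetPn[j] : ~~ ([set x in take k.+1 (order_by (start s))]
                        \subset [set x in take k (order_by r)]).
  apply/negP => /subset_leq_card; rewrite !cardsE.
  rewrite !(card_uniqP _) ?take_uniq ?uniq_order_by //.
  by rewrite !size_takel ?size_order_by ?ltnn // ltnW.
rewrite !inE !in_take ?mem_order_by // -leqNgt => j_start j_release.
have [tau tau_in /andP[rel_tau tau_start]] := job_served j.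
exists tau => //.
rewrite (le_trans _ rel_tau) /=.
  rewrite (le_trans tau_start) // -(nth_by_index 0 (start s)).
  by apply: le_nth_by; rewrite -ltnS j_start.
rewrite ler_nat -(nth_by_index 0%N r j).
by apply: (le_nth_by 0%N r); rewrite j_release index_order_by_lt.
Qed.

Lemma feasible_fifo_schedule :
  feasible r s -> fifo_schedule n release (replenishments s) nth_start.
Proof.
move=> feas; split; first by have [] := feas.
  exact: feasible_spaced.
exact: feasible_served.
Qed.

Lemma sum_flow_time_nth_start :
  \sum_(j < n) flow_time r s j = flow release nth_start 0 n.
Proof.
rewrite /flow_time /completion /flow !sumrB !big_split /=.
rewrite (sum_nth_by 0 (start s) id) (sum_nth_by 0%N r (fun x => x%:R)).
by rewrite -(sum_nth_by 0%N r (fun=> 1)).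
Qed.

Section OfFifoSchedule.
Variable sigma : nat -> R.
Hypothesis start_sigma : forall j, start s j = sigma (index j (order_by r)).

Lemma fifo_schedule_feasible :
  fifo_schedule n release (replenishments s) sigma -> feasible r s.
Proof.
case=> taus_sorted sp job_served; split=> // [i j ij|j].
  have before i' j' : (index i' (order_by r) < index j' (order_by r))%N ->
      start s i' + 1 <= start s j'.
    move=> lt_index.
    have /sp : (index i' (order_by r) <= index j' (order_by r) < n)%N.
      by rewrite (ltnW lt_index) index_order_by_lt.
    have : 1 <= (index j' (order_by r) - index i' (order_by r))%:R :> R.
      by rewrite ler1n subn_gt0.
    by rewrite !start_sigma; lra.
  have : index i (order_by r) != index j (order_by r).
    by apply: contra ij => /eqP /index_inj -> //; exact: mem_order_by.
  by rewrite neq_ltn => /orP[/before|/before]; [left | right].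
have := job_served (index j (order_by r)).
rewrite index_order_by_lt => /(_ isT).
by rewrite nth_by_index start_sigma.
Qed.

Lemma sum_flow_time_fifo :
  \sum_(j < n) flow_time r s j = flow release sigma 0 n.
Proof.
rewrite /flow -(sum_index_order_by r); apply: eq_bigr => j _.
by rewrite nth_by_index -start_sigma.
Qed.

End OfFifoSchedule.
End Feasible.

Lemma le_opt_cost (R : realType) (K : R) (n : nat) (r : 'I_n -> nat) (x : R) :
  (exists s : solution R n, feasible r s) ->
  (forall s, feasible r s -> x <= cost K r s) -> x <= opt_cost K r.
Proof.
move=> [s feas_s] x_le; apply: lb_le_inf; first by exists (cost K r s), s.
by move=> _ [s' feas_s' <-]; exact: x_le.
Qed.

(** * Runs of the algorithm *)

Lemma sorted_ltn_rcons_succ (s : seq nat) t :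
  sorted ltn (rcons s t) -> sorted ltn (rcons s t.+1).
Proof. by case: s => //= x s; rewrite !rcons_path => /andP[-> /leqW]. Qed.

Lemma sorted_ltn_rcons_iota (s : seq nat) t b :
  sorted ltn (rcons s t) -> sorted ltn (rcons (s ++ iota t b) (t + b)).
Proof.
move=> s_sorted; rewrite rcons_cat -cats1 -/(iota (t + b) 1) -iotaD addn1.
by rewrite sorted_cat_cons s_sorted; exact: (iota_ltn_sorted t b.+1).
Qed.

Lemma last_le_sorted_ltn (s : seq nat) t :
  sorted ltn (rcons s t) -> (last 0 s <= t)%N.
Proof. by case: s => //= x s; rewrite rcons_path => /andP[_ /ltnW]. Qed.

Lemma count_lt_split (d : Order.disp_t) (T : orderType d) (x y : T)
    (s : seq T) :
  (x <= y)%O ->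
  count (< y)%O s = (count (< x)%O s + count (fun z => (x <= z < y)%O) s)%N.
Proof.
move=> xy; elim: s => //= z s ->; rewrite addnACA; congr (_ + _)%N.
by have [zx|//] := ltP z x; rewrite (lt_le_trans zx).
Qed.

Lemma clock_run_ge (A : online_algorithm) n (r : 'I_n -> nat) N :
  (N <= clock (run A r N))%N.
Proof.
elim: N => // N IH; rewrite [run _ _ _]iterS /= -addn1.
by rewrite leq_add ?leq_maxl.
Qed.

Section Run.
Variables (R : realType) (K : R) (n : nat) (r : 'I_n -> nat).
Hypothesis K_ge0 : 0 <= K.
Local Notation by_release := (order_by r).
Local Notation release := (nth_by 0%N r).
Local Notation released_before := (released_before n release).

Lemma release_nondecreasing i j : (i <= j < n)%N -> (release i <= release j)%N.
Proof. exact: (le_nth_by 0%N r). Qed.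

Definition nth_started (L : log) (k : nat) : nat :=
  nth 0%N (unzip2 (started L)) k.

Definition started_flow (L : log) : R :=
  flow release (fun k => (nth_started L k)%:R) 0 (size (started L)).

Definition released_by_clock (L : log) : nat := released_before (clock L).+1.

Definition batch (L : log) : seq 'I_n :=
  drop (size (started L)) (take (released_by_clock L) by_release).

Definition batch_due (L : log) : bool :=
  (size (started L) < released_by_clock L)%N &&
  (K <= batch_flow release (clock L) (size (started L)) (released_by_clock L)).

Definition start_batch (L : log) : log :=
  Log (clock L + size (batch L))
      (started L ++
         zip [seq val j | j <- batch L] (iota (clock L) (size (batch L))))
      (rcons (replenished L) (clock L)).

Definition wait (L : log) : log := Log (clock L).+1 (started L) (replenished L).

Record fifo_log (L : log) : Prop := FifoLog {
  fifo_log_jobs :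
    unzip1 (started L) = [seq val j | j <- take (size (started L)) by_release];
  fifo_log_released :
    (released_before (last 0 (replenished L)) <= size (started L)
       <= released_before (clock L))%N;
  fifo_log_starts : sorted ltn (rcons (unzip2 (started L)) (clock L));
  fifo_log_replenished : sorted ltn (rcons (replenished L) (clock L));
  fifo_log_served : forall k, (k < size (started L))%N ->
    exists2 u, u \in replenished L & (release k <= u <= nth_started L k)%N
}.

Lemma released_by_clock_le_size L : (released_by_clock L <= n)%N.
Proof. exact: released_before_le_size. Qed.

Lemma size_batch L :
  size (batch L) = (released_by_clock L - size (started L))%N.
Proof.
by rewrite size_drop size_takel // size_order_by released_by_clock_le_size.
Qed.

Lemma unzip2_start_batch L :
  unzip2 (started (start_batch L))
  = unzip2 (started L) ++ iota (clock L) (size (batch L)).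
Proof.
rewrite /unzip2 map_cat -/(unzip2 (zip _ _)) unzip2_zip //.
by rewrite size_iota size_map.
Qed.

Lemma unzip1_start_batch L :
  unzip1 (started (start_batch L))
  = unzip1 (started L) ++ [seq val j | j <- batch L].
Proof.
rewrite /unzip1 map_cat -/(unzip1 (zip _ _)) unzip1_zip //.
by rewrite size_iota size_map.
Qed.

Lemma nth_started_start_batch L k : nth_started (start_batch L) k =
  if (k < size (started L))%N then nth_started L k
  else nth 0%N (iota (clock L) (size (batch L))) (k - size (started L)).
Proof. by rewrite /nth_started unzip2_start_batch nth_cat size_map. Qed.

Lemma release_le_clock L k :
  (k < released_by_clock L)%N -> (release k <= clock L)%N.
Proof.
move=> k_lt; rewrite -ltnS (ltn_released_before release_nondecreasing) //.
exact: leq_trans (released_by_clock_le_size L).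
Qed.

Section FifoLog.
Variable L : log.
Hypothesis fifoL : fifo_log L.

Lemma released_before_clock_between :
  (size (started L) <= released_before (clock L) <= released_by_clock L)%N.
Proof.
have /andP[_ ->] := fifo_log_released fifoL.
exact: leq_released_before (leqnSn _).
Qed.

Lemma size_started_le : (size (started L) <= released_by_clock L)%N.
Proof. by have /andP[] := released_before_clock_between; exact: leq_trans. Qed.

Lemma size_started_start_batch :
  size (started (start_batch L)) = released_by_clock L.
Proof.
rewrite size_cat size_zip size_map size_iota minnn size_batch.
by rewrite subnKC ?size_started_le.
Qed.

Lemma sort_backlog :
  sort (fun i j => (i.2 <= j.2)%N) (backlog (released r (clock L)) L)
  = [seq (val j, r j) | j <- batch L].
Proof.
rewrite /backlog /released filter_map sort_map -filter_predI.
rewrite -(filter_sort (leT := relpre r <=%O)); last 2 first.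
- by move=> x y; exact: le_total.
- by move=> x y z; exact: le_trans.
congr map; rewrite -/by_release.
have -> : batch L = [seq j <- by_release | j \in batch L].
  apply/subseq_uniqP; first exact: uniq_order_by.
  exact: subseq_trans (drop_subseq _ _) (take_subseq _ _).
apply: eq_in_filter => j _.
rewrite /= fifo_log_jobs // mem_map; last exact: val_inj.
have -> : (r j <= clock L)%N = (j \in take (released_by_clock L) by_release).
  rewrite in_take ?mem_order_by // -(nth_by_index 0%N r j) -ltnS.
  by rewrite (ltn_released_before release_nondecreasing) ?index_order_by_lt.
have := take_uniq (released_by_clock L) (uniq_order_by r).
rewrite -(cat_take_drop (size (started L)) (take _ _)) cat_uniq.
rewrite take_takel ?size_started_le //.
move=> /and3P[_ /hasPn disjoint _]; rewrite mem_cat andb_orr andNb /=.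
by apply: andb_idl => /disjoint.
Qed.

Lemma advance_Online_SumFj :
  advance (Online_SumFj K) r L = if batch_due L then start_batch L else wait L.
Proof.
rewrite /advance /Online_SumFj; set B := backlog _ _.
set by_date := fun i j : nat * nat => (i.2 <= j.2)%N.
have sortB : sort by_date B = [seq (val j, r j) | j <- batch L].
  exact: sort_backlog.
have sizeB : size B = size (batch L).
  by have := congr1 size sortB; rewrite size_sort size_map.
have waitingE : \sum_(j <- B) ((clock L)%:R - j.2%:R) =
    \sum_(size (started L) <= k < released_by_clock L)
      ((clock L)%:R - (release k)%:R) :> R.
  rewrite -(perm_big _ (permEl (perm_sort by_date B))) sortB big_map /=.
  rewrite -(big_map r predT (fun x => (clock L)%:R - x%:R)) (big_nth 0%N).
  rewrite size_map size_batch -{2}[size (started L)]add0n big_addn.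
  apply: eq_big_nat => i i_lt; rewrite map_drop map_take nth_drop nth_take //.
    by rewrite addnC.
  by rewrite -ltn_subRL.
rewrite waitingE sizeB -size_eq0 sizeB size_batch subn_eq0 -ltnNge -batch_flowE.
rewrite -/(batch_due L); case: ifP => [/andP[due _]|_]; last first.
  by rewrite /= cats0 addn1.
rewrite sortB /= /unzip1 -map_comp size_map (maxn_idPr _) //.
by rewrite size_batch subn_gt0.
Qed.

Lemma fifo_log_wait : fifo_log (wait L).
Proof.
case: fifoL => jobs /andP[released_lo released_hi] starts replenished served.
split=> //=; try exact: sorted_ltn_rcons_succ.
by rewrite released_lo (leq_trans released_hi) // leq_released_before.
Qed.

Lemma fifo_log_start_batch : batch_due L -> fifo_log (start_batch L).
Proof.
move=> /andP[due _]; case: fifoL => jobs _ starts replenished served.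
have b_gt0 : (0 < size (batch L))%N by rewrite size_batch subn_gt0.
split.
- rewrite unzip1_start_batch jobs size_started_start_batch -map_cat.
  by rewrite -(take_takel by_release size_started_le) cat_take_drop.
- rewrite size_started_start_batch /= last_rcons !leq_released_before //.
  by rewrite -addn1 leq_add2l.
- by rewrite unzip2_start_batch; exact: sorted_ltn_rcons_iota.
- rewrite /= -cats1 cat_rcons sorted_cat_cons replenished /= andbT.
  by rewrite -addn1 leq_add2l.
- move=> k; rewrite size_started_start_batch nth_started_start_batch => k_lt.
  have [kc|ck] := ltnP k (size (started L)).
    have [u u_in release_u] := served k kc.
    by exists u; rewrite // mem_rcons inE u_in orbT.
  exists (clock L); first by rewrite mem_rcons mem_head.
  rewrite release_le_clock // nth_iota ?leq_addr //.
  by rewrite size_batch ltn_sub2r // (leq_ltn_trans ck).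
Qed.

Section Complete.
Hypothesis all_started : size (started L) = n.

Lemma complete_fifo_log : complete n L.
Proof.
move=> j; rewrite fifo_log_jobs // all_started take_oversize ?size_order_by //.
by rewrite mem_map ?mem_order_by //; exact: val_inj.
Qed.

Lemma start_solution_of j :
  start (solution_of R n L) j = (nth_started L (index j by_release))%:R.
Proof.
rewrite /= fifo_log_jobs // all_started take_oversize ?size_order_by //.
by rewrite index_map //; exact: val_inj.
Qed.

Lemma fifo_schedule_solution_of :
  fifo_schedule n release (replenishments (solution_of R n L))
    (fun k => (nth_started L k)%:R : R).
Proof.
case: fifoL => _ _ starts replenished served.
have sorted_init s t : sorted ltn (rcons s t) -> sorted ltn s.
  by apply: (subseq_sorted ltn_trans); exact: subseq_rcons.
split=> [||k /= kn].
- rewrite /= sorted_map; apply: sub_sorted (sorted_init _ _ replenished) => x y.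
  by rewrite /= ltr_nat.
- apply: spaced_succ => k k1n; rewrite natr1 ler_nat.
  apply: (sorted_ltn_nth ltn_trans 0%N (sorted_init _ _ starts)) => //.
    by rewrite inE size_map all_started ltnW.
  by rewrite inE size_map all_started.
- have [|u u_in /andP[release_u u_start]] := served k.
    by rewrite all_started.
  by exists u%:R; [exact: map_f | rewrite !ler_nat release_u].
Qed.

Lemma feasible_solution_of : feasible r (solution_of R n L).
Proof.
exact: fifo_schedule_feasible start_solution_of fifo_schedule_solution_of.
Qed.

Lemma cost_solution_of : cost K r (solution_of R n L) =
  started_flow L + (size (replenished L))%:R * K.
Proof.
rewrite /cost size_map /started_flow all_started; congr (_ + _).
exact: sum_flow_time_fifo start_solution_of.
Qed.

End Complete.
End FifoLog.

Local Notation A := (Online_SumFj K).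

Lemma fifo_log_run N : fifo_log (run A r N).
Proof.
elim: N => [|N IH]; first by split; rewrite /= ?take0 ?released_before0.
rewrite [run _ _ _]iterS -/(run A r N) (advance_Online_SumFj IH).
by case: ifP => [|_]; [exact: fifo_log_start_batch | exact: fifo_log_wait].
Qed.

Lemma runS N : run A r N.+1 =
  if batch_due (run A r N) then start_batch (run A r N) else wait (run A r N).
Proof. exact: advance_Online_SumFj (fifo_log_run N). Qed.

Lemma run_settled N : size (started (run A r N)) = n -> settled A r N.
Proof.
move=> all_started m /subnKC <-.
elim: (m - N)%N => [|d [startedE replenishedE]]; first by rewrite addn0.
rewrite addnS runS ifF //; apply/negbTE; rewrite negb_and -leqNgt startedE.
by rewrite all_started released_by_clock_le_size.
Qed.

Lemma released_by_clock_all L :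
  (forall j, r j <= clock L)%N -> released_by_clock L = n.
Proof.
move=> r_le; apply/eqP; rewrite eqn_leq released_by_clock_le_size leqNgt /=.
apply/negP => lt_n; have [j release_j] := nth_by_exists 0%N r lt_n.
have := ltn_released_before release_nondecreasing (clock L).+1 lt_n.
by rewrite release_j ltnS r_le ltnn.
Qed.

Lemma batch_due_late L : (forall j, r j + Num.bound K <= clock L)%N ->
  (size (started L) < n)%N -> batch_due L.
Proof.
move=> late lt_n; rewrite /batch_due released_by_clock_all => [|j]; last first.
  exact: leq_trans (leq_addr _ _) (late j).
rewrite lt_n /batch_flow (flow_cat _ _ (leqnSn _) lt_n).
rewrite {1}/flow big_nat1 subnn addn0 /=.
set others := flow _ _ _ n.
have others_ge0 : 0 <= others.
  apply: flow_ge0 => k /andP[_ kn]; rewrite ler_nat.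
  by have [j ->] := nth_by_exists 0%N r kn; have := late j; lia.
have [j ->] := nth_by_exists 0%N r lt_n.
have := late j; rewrite -(ler_nat R) natrD; have := archi_boundP K_ge0; lra.
Qed.

Lemma run_complete : exists N, size (started (run A r N)) = n.
Proof.
pose N := (\max_(j < n) r j + Num.bound K)%N; exists N.+1.
have fifoN := fifo_log_run N; rewrite runS; set L := run A r N in fifoN *.
have late j : (r j + Num.bound K <= clock L)%N.
  by apply: leq_trans (clock_run_ge _ r N); rewrite leq_add2r leq_bigmax.
have all_released : released_by_clock L = n.
  apply: released_by_clock_all => j; apply: leq_trans (late j).
  exact: leq_addr.
case: ifPn => due; first by rewrite size_started_start_batch.
have := size_started_le fifoN; rewrite all_released => le_n.
apply/eqP; rewrite eqn_leq /= le_n leqNgt.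
by apply: contra due; exact: batch_due_late.
Qed.

Section CostBound.
Variables (taus : seq R) (sigma : nat -> R).
Hypothesis fifo : fifo_schedule n release taus sigma.

Definition cost_bounded (L : log) : Prop :=
  started_flow L + (size (replenished L))%:R * K
  <= 2 * (flow release sigma 0 (size (started L))
    + (count (fun tau => tau < (last 0%N (replenished L))%:R) taus)%:R * K).

(* The first case holds after a batch, the second one after waiting. *)
Definition lead_bounded (L : log) : Prop :=
  lead_le_sqrt n K sigma (clock L) (size (started L)) \/
  exists2 u, clock L = u.+1 & small_backlog n release K u (size (started L)).

Lemma lead_bounded_wait L :
  fifo_log L -> ~~ batch_due L -> lead_bounded (wait L).
Proof.
move=> fifoL not_due; right; exists (clock L) => //.
move: not_due; rewrite negb_and -leqNgt -ltNge => /orP[le_c|/ltW //].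
by rewrite /small_backlog /batch_flow /flow big_geq.
Qed.

Lemma lead_bounded_start_batch L :
  fifo_log L -> lead_bounded L -> lead_bounded (start_batch L).
Proof.
move=> fifoL lead; left; rewrite size_started_start_batch // /= size_batch.
case: lead => [|[u clockE]]; first exact/lead_le_sqrt_batch/size_started_le.
rewrite clockE; apply: (small_backlog_lead_le_sqrt release_nondecreasing fifo).
by rewrite -clockE released_before_clock_between.
Qed.

Lemma lead_bounded_delay L : fifo_log L -> lead_bounded L ->
  delay_bounded release K sigma
    (clock L) (size (started L)) (released_by_clock L).
Proof.
move=> fifoL [lead|[u clockE]].
  apply: (lead_delay_bounded _ K_ge0 lead).
  by rewrite size_started_le ?released_by_clock_le_size.
rewrite clockE; apply: (small_backlog_delay_bounded release_nondecreasing fifo).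
  by rewrite -clockE released_before_clock_between.
exact: released_by_clock_le_size.
Qed.

Lemma started_flow_start_batch L : fifo_log L ->
  started_flow (start_batch L) = started_flow L
    + batch_flow release (clock L) (size (started L)) (released_by_clock L).
Proof.
move=> fifoL; rewrite /started_flow size_started_start_batch //.
rewrite (flow_cat _ _ (leq0n _) (size_started_le fifoL)).
congr (_ + _); apply: eq_big_nat => k /andP[ck ke].
  by rewrite nth_started_start_batch ke.
rewrite nth_started_start_batch ltnNge ck /= nth_iota //.
by rewrite size_batch ltn_sub2r // (leq_ltn_trans ck).
Qed.

Lemma cost_bounded_start_batch L : fifo_log L -> batch_due L ->
  lead_bounded L -> cost_bounded L -> cost_bounded (start_batch L).
Proof.
move=> fifoL /andP[due Kf] lead costL.
have /andP[released_lo _] := fifo_log_released fifoL.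
have ce : (size (started L) <= released_by_clock L
             <= released_before (clock L).+1)%N by rewrite size_started_le /=.
have delay := lead_bounded_delay fifoL lead.
have := batch_cost_le release_nondecreasing fifo K_ge0 released_lo ce Kf delay.
have wt := last_le_sorted_ltn (fifo_log_replenished fifoL).
rewrite /cost_bounded started_flow_start_batch // size_started_start_batch //.
rewrite (flow_cat release sigma (leq0n _) (size_started_le fifoL)).
rewrite [replenished _]/= size_rcons last_rcons -natr1.
set w := last 0%N _ in released_lo wt *.
rewrite (@count_lt_split _ _ w%:R (clock L)%:R) ?ler_nat // natrD.
move: costL; rewrite /cost_bounded -/w; lra.
Qed.

Lemma cost_bounded_run N : cost_bounded (run A r N).
Proof.
suff [] : cost_bounded (run A r N) /\ lead_bounded (run A r N) by [].
elim: N => [|N [costN leadN]].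
  split.
    rewrite /cost_bounded /started_flow /flow !big_geq //= mul0r !add0r.
    by rewrite !mulr_ge0.
  left=> k /= kn; rewrite add0n subn0.
  have := fifo_spaced fifo (i := 0%N) (j := k) kn; rewrite subn0.
  have /(fifo_release_le fifo) : (0 < n)%N by exact: leq_ltn_trans kn.
  by have := sqrtr_ge0 K; have : 0 <= (release 0)%:R :> R by []; lra.
have fifoN := fifo_log_run N; rewrite runS; case: ifPn => due.
  by split; [exact: cost_bounded_start_batch | exact: lead_bounded_start_batch].
by split=> //; exact: lead_bounded_wait.
Qed.

End CostBound.

Lemma cost_run_le N s : size (started (run A r N)) = n -> feasible r s ->
  cost K r (solution_of R n (run A r N)) <= 2 * cost K r s.
Proof.
move=> all_started /feasible_fifo_schedule fifo.
rewrite cost_solution_of //; last exact: fifo_log_run.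
apply: le_trans (cost_bounded_run fifo N) _; rewrite all_started ler_pM2l //.
rewrite /cost sum_flow_time_nth_start lerD2l.
by rewrite ler_wpM2r // ler_nat count_size.
Qed.

End Run.

Theorem theorem13 (R : realType) (K : R) (hK : 0 <= K) :
  competitive K 2 (Online_SumFj K).
Proof.
move=> n r; have [N all_started] := run_complete r hK.
have fifoN := fifo_log_run K r N.
have feasN := feasible_solution_of R fifoN all_started.
exists (solution_of R n (run (Online_SumFj K) r N)); split=> //.
  exists N; split=> //; first exact: run_settled.
  exact: complete_fifo_log fifoN all_started.
rewrite mulrC -ler_pdivrMr //; apply: le_opt_cost => [|s feas_s].
  by exists (solution_of R n (run (Online_SumFj K) r N)).
by rewrite ler_pdivrMr // mulrC; exact: cost_run_le.
Qed.
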